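(* Let $G$ be an $n$-vertex graph with $\kappa(G)\ge\alpha(G)$, and let $r=\left\lfloor\frac{\kappa(G)-\alpha(G)}{2}\right\rfloor$. Then $G$ contains $C^r_n$ as a subgraph, i.e. a Hamilton cycle $v_1v_2\cdots v_nv_1$ of $G$ such that the edges $v_1v_3,v_3v_5,\ldots,v_{2r-1}v_{2r+1}$ are also edges of $G$.
   Context: All graphs are finite and simple. $\alpha(G)$ is the independence number of $G$; $\kappa(G)$ is the connectivity of $G$ (the minimum number of vertices whose removal makes $G$ disconnected or reduces it to a single vertex). For integers $\ell\ge3$, $r\ge0$, $C^r_\ell$ denotes the graph consisting of a cycle $v_1v_2\cdots v_\ell v_1$ together with the additional edges $v_1v_3,v_3v_5,\ldots,v_{2r-1}v_{2r+1}$ (for $r=0$ just the cycle). *)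

(* Defs.v *)
From mathcomp Require Import all_boot.

Set Implicit Arguments.
Unset Strict Implicit.
Unset Printing Implicit Defensive.

(* A graph on T is given by its adjacency relation. *)
Definition simple_graph (T : finType) (e : rel T) : Prop :=
  symmetric e /\ irreflexive e.

Definition independent (T : finType) (e : rel T) (S : {set T}) : bool :=
  [forall x in S, forall y in S, ~~ e x y].

Definition alpha (T : finType) (e : rel T) : nat :=
  \max_(S : {set T} | independent e S) #|S|.

Definition delete_vertices (T : finType) (e : rel T) (S : {set T}) : rel T :=
  [rel x y | [&& x \notin S, y \notin S & e x y]].

Definition disconnects (T : finType) (e : rel T) (S : {set T}) : bool :=
  [exists x, exists y,
    [&& x \notin S, y \notin S & ~~ connect (delete_vertices e S) x y]].

(* If T is nonempty, the complement of any singleton is admissible and has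
   fewer than #|T| elements, so the default value #|T| is never attained. *)
Definition kappa (T : finType) (e : rel T) : nat :=
  \big[minn/#|T|]_(S : {set T} | disconnects e S || (#|~: S| == 1)) #|S|.

(* The graph C^r_l, for l >= 3 and 2r + 1 <= l. The vertex v_i is the ordinal
   i - 1, so that the k-th chord v_(2k-1)v_(2k+1), 1 <= k <= r, joins the
   ordinals 2m and 2m + 2 with m = k - 1 < r. *)
Definition cycle_chords (l r : nat) : rel 'I_l :=
  [rel i j : 'I_l |
    [|| i.+1 %% l == j, j.+1 %% l == i |
        [exists m : 'I_r, ((i == m.*2 :> nat) && (j == m.*2.+2 :> nat))
                       || ((j == m.*2 :> nat) && (i == m.*2.+2 :> nat))]]].

Arguments cycle_chords l r : clear implicits.

Definition contains_subgraph (T U : finType) (e : rel T) (h : rel U) : Prop :=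
  exists v : U -> T, injective v /\ forall i j, h i j -> e (v i) (v j).

(* Main.v *)
(** Each vertex has degree at least [kappa >= alpha + 2r], so greedily, for fewer
    than [r] triangles, the unused neighbours of the current endpoint outnumber
    [alpha] and span an edge; this yields a strip of [r] triangles, traversed by
    a path [v :: p] with [2r] edges.  Deleting the interior of that path does
    not disconnect the graph, so the path closes up to a cycle; take a longest
    cycle through it.  If a component [H] of the complement is left over, its
    attachments [A] on the cycle separate [H] from another vertex of the cycle,
    so [#|A| >= kappa].  Discarding the at most [2r] attachments whose outgoing
    cycle edge lies on the path, the successors of the remaining ones together
    with a vertex of [H] form an independent set, by the Chvatal-Erdos rerouting
    argument, and there are more than [alpha] of them. *)

Require Import Defs.
From mathcomp Require Import all_boot.
From mathcomp Require Import zify.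

Set Implicit Arguments.
Unset Strict Implicit.
Unset Printing Implicit Defensive.

(** * Bounds from connectivity and independence *)

Lemma bigminn_le (I : eqType) (r : seq I) (P : pred I) (F : I -> nat) n i :
  i \in r -> P i -> \big[minn/n]_(j <- r | P j) F j <= F i.
Proof.
elim: r => // j r IHr; rewrite inE big_cons => /predU1P[<- ->|ir Pi].
  exact: geq_minl.
case: ifP => _; last exact: IHr.
by rewrite geq_min IHr ?orbT.
Qed.

Lemma kappa_le (T : finType) (e : rel T) (S : {set T}) :
  disconnects e S || (#|~: S| == 1) -> kappa e <= #|S|.
Proof. by move=> dS; apply: bigminn_le => //; apply: mem_index_enum. Qed.

(** Edges leave [X] only into [S], so after deleting [S] a walk from [x] stays in [X] and never
    meets [y]. *)
Lemma kappa_sep (T : finType) (e : rel T) (S X : {set T}) x y :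
    x \in X -> y \notin X -> x \notin S -> y \notin S ->
    (forall a b, a \in X -> e a b -> b \in X :|: S) ->
  kappa e <= #|S|.
Proof.
move=> xX yX xS yS clX; apply: kappa_le; apply/orP; left.
apply/existsP; exists x; apply/existsP; exists y; rewrite xS yS /=.
apply: contra yX => /connectP[s + ->].
elim: s x xX {xS} => //= z s IHs x xX /andP[/and3P[_ zS exz]]; apply: IHs.
by move: (clX _ _ xX exz); rewrite inE (negPf zS) orbF.
Qed.

Lemma connect_of_lt_kappa (T : finType) (e : rel T) (S : {set T}) x y :
    #|S| < kappa e -> x \notin S -> y \notin S ->
  connect (delete_vertices e S) x y.
Proof.
move=> ltS xS yS; apply: contraLR ltS => Nxy; rewrite -leqNgt kappa_le //.
apply/orP; left; apply/existsP; exists x; apply/existsP; exists y.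
by rewrite xS yS.
Qed.

Lemma kappa_le_degree (T : finType) (e : rel T) v :
  irreflexive e -> kappa e <= #|[set x | e v x]|.
Proof.
move=> irr; set N := [set x | e v x].
have vN : v \notin N by rewrite inE irr.
case: (boolP [exists y, (y != v) && (y \notin N)]).
  case/existsP=> y /andP[yv yN].
  apply: (kappa_sep (set11 v) _ vN yN); first by rewrite inE.
  by move=> a b /set1P-> evb; rewrite !inE evb orbT.
rewrite negb_exists => /forallP allN; apply: kappa_le; apply/orP; right.
rewrite -(cards1 v); apply/eqP; congr #|pred_of_set _|; apply/setP=> y.
rewrite in_setC in_set1; have := allN y; rewrite negb_and !negbK.
by have [->|_] := eqVneq y v; rewrite ?vN //= => ->.
Qed.

Lemma independent_le_alpha (T : finType) (e : rel T) (S : {set T}) :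
  {in S &, forall x y, ~~ e x y} -> #|S| <= alpha e.
Proof.
move=> indS; apply: (bigmax_sup S) => //.
by apply/forall_inP=> x xS; apply/forall_inP=> y; apply: indS.
Qed.

Lemma edge_of_alpha_lt (T : finType) (e : rel T) (S : {set T}) :
  alpha e < #|S| -> exists x y, [/\ x \in S, y \in S & e x y].
Proof.
move=> ltS; suff /exists_inP[x xS /exists_inP[y yS exy]] :
  [exists x in S, exists y in S, e x y] by exists x, y.
apply: contraLR ltS => Nedge; rewrite -leqNgt; apply: independent_le_alpha.
move=> x y xS yS; apply: contra Nedge => exy.
by apply/exists_inP; exists x => //; apply/exists_inP; exists y.
Qed.

Lemma alpha_gt0 (T : finType) (e : rel T) (v : T) : irreflexive e -> 0 < alpha e.
Proof.
move=> irr; rewrite -(cards1 v); apply: independent_le_alpha.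
by move=> x y /set1P-> /set1P->; rewrite irr.
Qed.

Lemma path_delete_vertices (T : finType) (e : rel T) (S : {set T}) x s :
  path (delete_vertices e S) x s ->
  path e x s /\ {in s, forall z, z \notin S}.
Proof.
elim: s x => //= y s IHs x /andP[/and3P[_ yS ->] /IHs[-> sS]]; split=> // z.
by rewrite inE => /predU1P[->|/sS].
Qed.

Lemma connect_delete_path (T : finType) (e : rel T) (S : {set T}) x y :
    connect (delete_vertices e S) x y ->
  exists s, [/\ path e x s, last x s = y, uniq (x :: s)
              & {in s, forall z, z \notin S}].
Proof.
case/connectP=> s /shortenP[s' es' us' _] ->.
by have [es s'S] := path_delete_vertices es'; exists s'.
Qed.

(** * The strip of triangles and its closure to a cycle *)

Lemma triangle_strip (T : finType) (e : rel T) (v : T) r :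
    symmetric e -> irreflexive e -> alpha e + r.*2 <= kappa e ->
  exists p, [/\ size p = r.*2, uniq (v :: p), path e v p &
    forall m, m < r -> e (nth v (v :: p) m.*2) (nth v (v :: p) m.*2.+2)].
Proof.
move=> sym irr; elim: r => [|r IHr] le_r; first by exists [::].
have [|p [sz_p Up ep chords]] := IHr; first by lia.
pose u := last v p; pose N := [set x | e u x] :\: [set x in v :: p].
have : alpha e < #|N|.
  have := kappa_le_degree u irr; rewrite -(cardsID [set x in v :: p]) -/N.
  set M := _ :&: _; suff : #|M| <= r.*2 by lia.
  (* Of the [r.*2.+1] used vertices, [u] itself is not a neighbour of [u], so at most [r.*2]
     neighbours are lost. *)
  have sMp : M \subset [set x in belast v p].
    apply/subsetP=> z; rewrite !inE => /andP[euz].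
    rewrite -in_cons lastI mem_rcons inE => /predU1P[zu|//].
    by rewrite zu irr in euz.
  apply: leq_trans (subset_leq_card sMp) _.
  by rewrite cardsE -sz_p -(size_belast v p) card_size.
case/edge_of_alpha_lt=> x [y [+ + exy]].
rewrite !inE -!in_cons => /andP[xp eux] /andP[yp euy].
(* The new triangle is [u], [x], [y]; its side from [u] to [y] is the new chord. *)
exists (p ++ [:: x; y]); split.
- by rewrite size_cat sz_p addn2.
- rewrite -cat_cons cat_uniq Up /= inE !orbF andbT; apply/andP; split.
    by rewrite negb_or xp yp.
  by rewrite inE; apply: contraTneq exy => ->; rewrite irr.
- by rewrite cat_path ep /= -/u eux exy.
move=> m; rewrite ltnS leq_eqVlt -cat_cons !nth_cat /= sz_p.
case/predU1P=> [->|lt_mr]; last first.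
  by have := chords m lt_mr; rewrite !ifT //; lia.
rewrite ltnS leqnn ifF; last by lia.
by rewrite subSS subSnn -{1}sz_p -[X in nth v _ X]/(size (v :: p)).-1 nth_last.
Qed.

(* [Q] leads from the end of [v :: p] back to [v], which is its last element: the
   cycle is [p ++ Q] up to rotation. *)
Lemma closing_path (T : finType) (e : rel T) (v : T) p :
    symmetric e -> irreflexive e -> 0 < kappa e -> size p <= kappa e ->
    uniq (v :: p) ->
  exists Q, [/\ Q != [::], path e (last v p) Q, last v (p ++ Q) = v
              & uniq (p ++ Q)].
Proof.
move=> sym irr k_gt0; case: (lastP p) => [_ _|p0 w].
  (* For empty [p] the degenerate closed walk from [v] to a neighbour and back suffices as a
     starting candidate. *)
  have := leq_trans k_gt0 (kappa_le_degree v irr).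
  case/card_gt0P=> b; rewrite inE => evb; exists [:: b; v].
  have nbv : b != v by apply: contraTneq evb => ->; rewrite irr.
  by split; rewrite //= ?inE ?nbv ?evb // 1?sym ?evb.
(* [S] is the interior of the path: both ends [v] and [w] are left out, which makes [S] smaller than
   [kappa e]. *)
rewrite size_rcons => le_k up; pose S := [set z in p0].
have ltS : #|S| < kappa e by apply: leq_ltn_trans le_k; rewrite cardsE card_size.
move: (up); rewrite /= rcons_uniq mem_rcons inE negb_or.
case/and3P=> /andP[nvw vp0] wp0 up0.
have vS : v \notin S by rewrite inE.
have wS : w \notin S by rewrite inE.
have := connect_of_lt_kappa ltS wS vS.
case/connect_delete_path=> h [eh lh uh hS]; exists h; split.
- by apply: contraNneq nvw => h0; rewrite -lh h0.
- by rewrite last_rcons.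
- by rewrite last_cat last_rcons.
rewrite cat_rcons cat_uniq up0 uh andbT; apply/hasPn=> z.
by rewrite inE => /predU1P[->//|/hS]; rewrite inE.
Qed.

(** * Rerouting and longest cycles *)

Lemma mem_belast_take (T : eqType) (w z : T) Q :
  z \in belast w Q -> exists2 k, k < size Q & last w (take k Q) = z.
Proof.
elim: Q w => //= x Q IHQ w; rewrite inE => /predU1P[->|/IHQ[k lt_k zk]].
  by exists 0.
by exists k.+1.
Qed.

(** The Chvatal-Erdos detour: after [Q1], cross [y :: h], enter [b :: Q2] at its far end, traverse
    it backwards, and rejoin at [d] by the edge from [b]. *)
Lemma path_detour_rev (T : eqType) (e : rel T) w y h Q1 b Q2 d Q3 :
    symmetric e ->
    path e w (Q1 ++ (b :: Q2) ++ d :: Q3) ->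
    e (last w Q1) y -> path e y h -> e (last y h) (last b Q2) -> e b d ->
  path e w (Q1 ++ (y :: h) ++ rev (b :: Q2) ++ d :: Q3).
Proof.
move=> sym; rewrite !cat_path /=.
move=> /and3P[-> /andP[_ eQ2] /andP[_ eQ3]] -> -> ehb ebd /=.
rewrite lastI rev_rcons /= ehb /= rev_path.
rewrite (eq_path (e' := e)) => [|c1 c2]; last exact: sym.
rewrite eQ2 eQ3 andbT /=; case: Q2 {eQ2 ehb} => //= q Q2.
by rewrite rev_cons last_rcons.
Qed.

(** Maximality compares only cycles with the same [p], so every rerouting has to take place inside
    [Q]. *)
Lemma longest_cycle_hamiltonian (T : finType) (e : rel T) (v : T) p Q :
    symmetric e -> irreflexive e -> alpha e + size p <= kappa e ->
    Q != [::] -> path e (last v p) Q -> last v (p ++ Q) = v ->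
    uniq (p ++ Q) ->
    (forall Q', path e (last v p) Q' -> last v (p ++ Q') = v ->
       uniq (p ++ Q') -> size Q' <= size Q) ->
  size (p ++ Q) = #|T|.
Proof.
move=> sym irr le_k Qn0 eQ lastQ uQ maxQ; pose w := last v p.
pose C := [set z in p ++ Q].
have cardC : #|C| = size (p ++ Q) by rewrite cardsE; apply/card_uniqP.
apply/eqP; rewrite eqn_leq -cardC max_card /= leqNgt; apply/negP=> ltC.
have /card_gt0P[x] : 0 < #|~: C| by rewrite cardsCs setCK subn_gt0.
rewrite inE => xC {ltC cardC}.
pose H := [set z | connect (delete_vertices e C) x z].
have xH : x \in H by rewrite inE connect0.
have symD : connect_sym (delete_vertices e C).
  by apply: sym_connect_sym => a b; rewrite /delete_vertices /= andbCA sym.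
have HC z : z \in H -> z \notin C.
  rewrite inE => /connect_delete_path[s [_ <- _ sC]].
  case: (lastP s) sC => //= s' a; rewrite last_rcons.
  by apply; rewrite mem_rcons mem_head.
have link y z : y \in H -> z \in H ->
    exists h, [/\ path e y h, last y h = z, uniq (y :: h)
                & {in y :: h, forall a, a \notin p ++ Q}].
  rewrite !inE => xy xz; have yC : y \notin C by apply: HC; rewrite inE.
  have : connect (delete_vertices e C) y z.
    by rewrite (connect_trans _ xz) // symD.
  case/connect_delete_path=> h [eh lh uh hC]; exists h; split=> // a.
  by rewrite inE => /predU1P[->|/hC]; [move: yC|]; rewrite inE.
(* A path with the same ends that visits [Q] and the extra vertices [h] contradicts [maxQ]. *)
have longer h Q' : 0 < size h -> uniq h -> {in h, forall a, a \notin p ++ Q} ->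
    perm_eq Q' (h ++ Q) -> last w Q' = last w Q -> path e w Q' -> False.
  move=> h_gt0 uh hQ pQ' lQ' eQ'.
  have : size Q' <= size Q.
    apply: maxQ => //; first by rewrite last_cat lQ' -last_cat.
    rewrite (perm_uniq (s2 := h ++ p ++ Q)).
      rewrite cat_uniq uh uQ andbT /=; apply/hasPn=> a aQ.
      by apply: contraL aQ; apply: hQ.
    by rewrite perm_sym perm_catCA perm_cat2l perm_sym.
  by rewrite (perm_size pQ') size_cat; lia.
(* The ends of a cycle edge on [Q] cannot both attach to [H]: a path through [H] could replace that
   edge. *)
have no_insert Q1 b Q3 y z : Q = Q1 ++ b :: Q3 -> y \in H -> z \in H ->
    e (last w Q1) y -> e z b -> False.
  move=> defQ yH zH ey ez; have [h [eh lh uh hC]] := link y z yH zH.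
  apply: (longer (y :: h) (Q1 ++ (y :: h) ++ b :: Q3)) => //.
  - by rewrite defQ perm_catCA.
  - by rewrite defQ !last_cat.
  move: eQ; rewrite -/w defQ !cat_path /=.
  by case/and3P=> -> _ ->; rewrite ey eh lh ez.
have no_reroute Q1 b Q2 d Q3 y z : Q = Q1 ++ (b :: Q2) ++ d :: Q3 ->
    y \in H -> z \in H -> e (last w Q1) y -> e z (last b Q2) -> e b d -> False.
  move=> defQ yH zH ey ez ebd; have [h [eh lh uh hC]] := link y z yH zH.
  apply: (longer (y :: h) (Q1 ++ (y :: h) ++ rev (b :: Q2) ++ d :: Q3)) => //.
  - rewrite defQ perm_catCA perm_cat2l perm_cat2l perm_cat2r.
    by rewrite perm_rev.
  - by rewrite defQ !last_cat.
  by apply: path_detour_rev; rewrite -?defQ ?lh.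
pose A := [set a in C | [exists y in H, e a y]].
have le_kA : kappa e <= #|A|.
  (* For [A] to separate, some cycle vertex must lie outside it: either [w] or, by [no_insert], its
     successor. *)
  have [y yC yA] : exists2 y, y \in C & y \notin A.
    have wC : w \in C.
      rewrite inE /w; case: (lastP p) lastQ => [/= <-|p' w' _].
        by case: (Q) Qn0 => //= b Q' _; apply: mem_last.
      by rewrite last_rcons mem_cat mem_rcons mem_head.
    have [wA|] := boolP (w \in A); last by exists w.
    case defQ: Q Qn0 => [//|b Q'] _.
    have bC : b \in C by rewrite inE defQ mem_cat mem_head orbT.
    exists b => //; apply/negP=> bA.
    move: wA bA; rewrite !inE => /andP[_ /exists_inP[y yH wy]].
    case/andP=> _ /exists_inP[z zH bz].
    by apply: (no_insert [::] b Q' y z) => //; rewrite sym.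
  have xA : x \notin A by rewrite inE (negPf xC).
  apply: (kappa_sep xH _ xA yA); first by apply: contraL yC => /HC.
  move=> a b aH eab; have [bC|bC] := boolP (b \in C).
    rewrite !inE orbC; move: bC; rewrite inE => -> /=.
    by apply/orP; left; apply/exists_inP; exists a => //; rewrite sym.
  rewrite inE; apply/orP; left; move: (aH); rewrite !inE => xa.
  apply: connect_trans xa (connect1 _).
  by rewrite /delete_vertices /= (HC a aH) bC eab.
(* The cycle edge with index [k] runs from [last w (take k Q)] to [nth v Q k]. *)
pose K := [set k : 'I_(size Q) | last w (take k Q) \in A].
have le_AK : #|A| <= size p + #|K|.
  pose f (k : 'I_(size Q)) := last w (take k Q).
  (* Attachments whose outgoing edge lies on the path are in [belast v p]; all others are indexed by
     [K]. *)
  suff sA : A \subset [set z in belast v p] :|: f @: K.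
    apply: leq_trans (subset_leq_card sA) _.
    apply: leq_trans (leq_card_setU _ _) _; apply: leq_add.
      by rewrite cardsE -(size_belast v p) card_size.
    exact: leq_imset_card.
  apply/subsetP=> z zA; rewrite !inE.
  have : z \in belast v (p ++ Q).
    have : z \in p ++ Q by move: zA; rewrite !inE => /andP[].
    have : z \in v :: (p ++ Q) -> z \in rcons (belast v (p ++ Q)) v.
      by rewrite lastI lastQ.
    rewrite inE mem_rcons inE => Hz zpQ.
    have [->|zv] := eqVneq z v; last first.
      by move: Hz; rewrite zpQ (negPf zv) orbT; apply.
    by case: (p ++ Q) zpQ => //= b s _; rewrite mem_head.
  rewrite belast_cat mem_cat => /orP[->//|/mem_belast_take[k lt_k zk]].
  apply/orP; right; apply/imsetP; exists (Ordinal lt_k) => //.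
  by rewrite inE /= zk.
pose g (k : 'I_(size Q)) := nth v Q k.
have split_at k : k < size Q -> Q = take k Q ++ nth v Q k :: drop k.+1 Q.
  by move=> lt_k; rewrite -drop_nth // cat_take_drop.
have indK : {in K &, forall k l : 'I_(size Q), k < l -> ~~ e (g k) (g l)}.
  move=> k l; rewrite !inE => /andP[_ /exists_inP[y yH ey]].
  case/andP=> _ /exists_inP[z zH ez] lt_kl; apply/negP=> ekl.
  have lt_k : k < size (take l Q).
    by rewrite size_take_min (minn_idPl (ltnW (ltn_ord l))).
  have defl : take l Q = take k Q ++ g k :: drop k.+1 (take l Q).
    rewrite -{1}(cat_take_drop k (take l Q)) take_takel ?(ltnW lt_kl) //.
    by rewrite (drop_nth v) // nth_take.
  (* The segment from [g k] up to the attachment just before [g l] is the one reversed. *)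
  apply: (no_reroute (take k Q) (g k) (drop k.+1 (take l Q)) (g l)
    (drop l.+1 Q) y z) => //.
    by rewrite catA -defl; apply: split_at.
  by rewrite sym; move: ez; rewrite {1}defl last_cat.
have uQ2 : uniq Q by move: uQ; rewrite cat_uniq => /and3P[].
have injg : injective g.
  by move=> k l /eqP; rewrite nth_uniq // => /eqP /val_inj.
have indx : {in K, forall k, ~~ e x (g k)}.
  move=> k; rewrite !inE => /andP[_ /exists_inP[y yH ey]]; apply/negP=> exk.
  exact: (no_insert _ _ _ y x (split_at k (ltn_ord k)) yH xH ey exk).
have : #|x |: g @: K| <= alpha e.
  apply: independent_le_alpha => a b /setU1P[->|/imsetP[k kK ->]].
    by case/setU1P=> [->|/imsetP[l lK ->]]; [rewrite irr | apply: indx].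
  case/setU1P=> [->|/imsetP[l lK ->]]; first by rewrite sym indx.
  have [lt_kl|lt_lk|/val_inj->] := ltngtP k l; last by rewrite irr.
    exact: indK.
  by rewrite sym indK.
(* The independent set has [#|K|.+1] elements, while [#|K|] is at least [kappa e - size p], hence at
   least [alpha e]. *)
rewrite cardsU1 card_imset // (_ : x \notin _) ?add1n; first by lia.
by apply: contra xC => /imsetP[k _ ->]; rewrite inE mem_cat mem_nth ?orbT.
Qed.

(** * From the strip to the Hamilton cycle with chords *)

Lemma spanning_cycle_through (T : finType) (e : rel T) (v : T) p :
    symmetric e -> irreflexive e -> alpha e + size p <= kappa e ->
    uniq (v :: p) ->
  exists Q, [/\ path e (last v p) Q, last v (p ++ Q) = v, uniq (p ++ Q)
              & size (p ++ Q) = #|T|].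
Proof.
move=> sym irr le_k up.
have k_gt0 : 0 < kappa e by have := alpha_gt0 v irr; lia.
pose valid Q := [&& path e (last v p) Q, last v (p ++ Q) == v & uniq (p ++ Q)].
have [Q0 [Q0n0 eQ0 lQ0 uQ0]] : exists Q, [/\ Q != [::], path e (last v p) Q,
    last v (p ++ Q) = v & uniq (p ++ Q)].
  by apply: closing_path => //; lia.
(* Tuples of fixed length make [P] decidable, so a greatest length can be chosen; uniqueness bounds
   it by [#|T|]. *)
pose P m := [exists t : m.-tuple T, valid t].
have PQ Q : valid Q -> P (size Q).
  by move=> vQ; apply/existsP; exists (in_tuple Q).
have exP : exists m, P m.
  by exists (size Q0); apply: PQ; rewrite /valid eQ0 lQ0 eqxx.
have boundP m : P m -> m <= #|T|.
  case/existsP=> t /and3P[_ _ ut]; rewrite -(size_tuple t).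
  have /card_uniqP <- : uniq t by move: ut; rewrite cat_uniq => /and3P[].
  exact: max_card.
case: (ex_maxnP exP boundP) => m /existsP[t /and3P[et /eqP lt ut]] maxm.
exists t; split=> //; apply: (@longest_cycle_hamiltonian _ e v) => //; last first.
  move=> Q eQ lQ uQ; rewrite size_tuple; apply/maxm/PQ.
  by rewrite /valid eQ lQ eqxx.
rewrite -size_eq0 -lt0n size_tuple; apply: leq_trans (maxm (size Q0) _).
  by rewrite lt0n size_eq0.
by apply: PQ; rewrite /valid eQ0 lQ0 eqxx.
Qed.

Theorem theorem2p6 (n : nat) (T : finType) (e : rel T)
    (n_ge3 : 3 <= n) (card_T : #|T| = n) (simple_e : simple_graph e)
    (alpha_le_kappa : alpha e <= kappa e) :
  contains_subgraph e (cycle_chords n ((kappa e - alpha e) %/ 2)).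
Proof.
have [sym irr] := simple_e; set r := _ %/ 2.
have le_r : alpha e + r.*2 <= kappa e.
  by have := leq_divM (kappa e - alpha e) 2; rewrite -/r muln2; lia.
have /card_gt0P[v _] : 0 < #|T| by lia.
have [p [sz_p up ep chords]] := triangle_strip v sym irr le_r.
rewrite -sz_p in le_r.
have [Q [eQ lQ uQ sz]] := spanning_cycle_through sym irr le_r up.
pose s := p ++ Q; have {}sz : size s = n by rewrite -card_T.
have es : path e v s by rewrite cat_path ep.
(* [v :: s] has [n.+1] entries and [v] at both ends; indices below [n] read each vertex once. *)
pose f (i : 'I_n) := nth v (v :: s) i.
(* Position [n] of [v :: s] holds [v] again, which matches the wrap to index 0. *)
have fS (i j : 'I_n) : i.+1 %% n = j -> nth v s i = f j.
  rewrite /f => <-; have [Ein|ne_in] := eqVneq i.+1 n.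
    by rewrite Ein modnn (_ : i = (size s).-1 :> nat) ?nth_last //=; lia.
  by rewrite modn_small // ltn_neqAle ne_in ltn_ord.
have fsym : forall i j : 'I_n, i.+1 %% n = j -> e (f i) (f j).
  move=> i j ij; rewrite -(fS i j ij); apply: (pathP v es).
  by rewrite sz.
exists f; split.
  have ub : uniq (belast v s).
    have : perm_eq (v :: s) (v :: belast v s).
      by rewrite lastI lQ perm_rcons.
    by rewrite perm_cons => /perm_uniq <-.
  have fb (i : 'I_n) : f i = nth v (belast v s) i.
    by rewrite /f lastI nth_rcons size_belast sz ltn_ord.
  move=> i j /eqP; rewrite !fb nth_uniq ?size_belast ?sz // => /eqP.
  exact: val_inj.
have chord (m : 'I_r) (i j : 'I_n) :
    i = m.*2 :> nat -> j = m.*2.+2 :> nat -> e (f i) (f j).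
  move=> im jm; have := chords m (ltn_ord m).
  by rewrite /f im jm -cat_cons !nth_cat /= sz_p !ifT //; have := ltn_ord m; lia.
move=> i j /or3P[/eqP/fsym//|/eqP/fsym|/existsP[m]]; first by rewrite sym.
case/orP=> /andP[/eqP im /eqP jm]; first exact: chord im jm.
by rewrite sym; apply: chord im jm.
Qed.
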